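(* Let $\Omega\subset\mathbb{R}^N$ be a bounded open set, let $p>1$, $p'=\frac{p}{p-1}$, and assume that $1\le m<\max\{1,\frac{N}{3p'}\}$. Then there exists $f\in L^m(\Omega)$, with $f\ge0$ and $f$ not identically zero, such that for all $\lambda>0$ the problem $$\Delta^2u=|\nabla u|^p+\lambda f\ \text{ in }\Omega,\qquad u=\Delta u=0\ \text{ on }\partial\Omega,\qquad u\ge0\ \text{ in }\Omega$$ has no positive solution.
   Context: A solution of the fourth order problem is a function $u\ge0$ such that, with $v=-\Delta u$, the pair $(u,v)$ is a weak solution of the system $-\Delta u=v$, $-\Delta v=|\nabla u|^p+\lambda f$ in $\Omega$, $u=v=0$ on $\partial\Omega$, $u,v\ge0$, in the following sense: $(u,v)\in W^{1,p}_0(\Omega)\times W^{1,1}_0(\Omega)$, $u,v\ge 0$, and for all $\varphi,\psi\in\mathcal{C}^\infty_0(\Omega)$, $$\int_\Omega\nabla\varphi\cdot\nabla u=\int_\Omega v\varphi,\qquad\int_\Omega\nabla\psi\cdot\nabla v=\int_\Omega|\nabla u|^p\psi+\lambda\int_\Omega f\psi .$$ A positive solution is a solution $u\ge 0$ that is not identically zero. *)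

(* Defs.v *)
From HB Require Import structures.
From mathcomp Require Import all_boot all_order all_algebra.
From mathcomp Require Import all_classical all_reals all_analysis.

Set Implicit Arguments.
Unset Strict Implicit.
Unset Printing Implicit Defensive.

Import Order.TTheory GRing.Theory Num.Theory.
Import numFieldNormedType.Exports.

Local Open Scope classical_set_scope.
Local Open Scope ring_scope.

(** R^N is ['rV[R]_N], with the sigma-algebra generated by the coordinates.
    This is the Borel sigma-algebra: open boxes with rational endpoints form a
    countable basis of the topology of ['rV[R]_N]. *)

Definition rV_display : measure_display.
Proof. exact: default_measure_display. Qed.

Section measurable_rV.
Context {R : realType} (n : nat).

Let coord_rV (i : 'I_n) (x : 'rV[R]_n) : measurableTypeR R := x ord0 i.

Let rV_set0 : g_sigma_preimage coord_rV set0.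
Proof. exact: sigma_algebra0. Qed.

Let rV_setC A : g_sigma_preimage coord_rV A -> g_sigma_preimage coord_rV (~` A).
Proof. exact: sigma_algebraC. Qed.

Let rV_bigcup (F : (set 'rV[R]_n)^nat) :
  (forall i, g_sigma_preimage coord_rV (F i)) ->
  g_sigma_preimage coord_rV (\bigcup_i (F i)).
Proof. exact: sigma_algebra_bigcup. Qed.

HB.instance Definition _ := @isMeasurable.Build rV_display
  'rV[R]_n (g_sigma_preimage coord_rV) rV_set0 rV_setC rV_bigcup.

End measurable_rV.

Lemma measurable_coord_rV {R : realType} n (i : 'I_n) :
  measurable_fun [set: 'rV[R]_n] (fun x => x ord0 i : measurableTypeR R).
Proof.
move=> _ Y mY; rewrite setTI; apply: sub_sigma_algebra => /=.
rewrite -bigcup_seq/=; exists i => /=; first by rewrite mem_index_enum.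
by exists Y => //; rewrite setTI.
Qed.

Lemma measurable_fun_rV {R : realType} d (T : measurableType d) n
    (f : T -> 'rV[R]_n) :
  (forall i, measurable_fun [set: T] (fun x => f x ord0 i : measurableTypeR R)) ->
  measurable_fun [set: T] f.
Proof.
move=> mf _ A mA; rewrite setTI; move: A mA.
apply: smallest_sub => /=.
  split => [|A|F] /=.
  - by rewrite preimage_set0.
  - by rewrite setTD -preimage_setC => /measurableC.
  - by rewrite preimage_bigcup => mF; exact: bigcupT_measurable.
rewrite -bigcup_seq; apply: bigcup_sub => i _.
by move=> _ [B mB <-]; rewrite setTI; have := mf i measurableT _ mB; rewrite setTI.
Qed.

Section lebesgue_measure_rV.
Context {R : realType}.

Definition rV_cons n (x : measurableTypeR R * 'rV[R]_n) : 'rV[R]_n.+1 :=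
  row_mx (x.1 : R)%:M x.2.

Lemma rV_cons0 n x : @rV_cons n x ord0 ord0 = x.1.
Proof.
have -> : ord0 = lshift n (ord0 : 'I_1) by exact: ord_inj.
by rewrite /rV_cons [LHS]row_mxEl mxE.
Qed.

Lemma rV_consS n x j : @rV_cons n x ord0 (lift ord0 j) = x.2 ord0 j.
Proof.
have -> : lift ord0 j = rshift 1 j by exact: ord_inj.
by rewrite /rV_cons [LHS]row_mxEr.
Qed.

Lemma measurable_rV_cons n : measurable_fun [set: _] (@rV_cons n).
Proof.
apply: measurable_fun_rV => i; case: (unliftP ord0 i) => [j|] ->.
- apply: (eq_measurable_fun ((fun y : 'rV[R]_n => y ord0 j) \o snd)).
    by move=> x _; rewrite rV_consS.
  by apply: measurableT_comp => //; exact: measurable_coord_rV.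
- by apply: (eq_measurable_fun fst) => // x _; rewrite rV_cons0.
Qed.

Section cons.
Context n (mu : {sigma_finite_measure set 'rV[R]_n -> \bar R}).

Definition lebesgue_rV_cons : set 'rV[R]_n.+1 -> \bar R :=
  pushforward (lebesgue_measure \x mu)%E (@rV_cons n).

Let lebesgue_rV_cons0 : lebesgue_rV_cons set0 = 0%E.
Proof. by apply: measure0; exact: measurable_rV_cons. Qed.

Let lebesgue_rV_cons_ge0 A : (0 <= lebesgue_rV_cons A)%E.
Proof. by apply: measure_ge0; exact: measurable_rV_cons. Qed.

Let lebesgue_rV_cons_sigma_additive : semi_sigma_additive lebesgue_rV_cons.
Proof.
by apply: measure_semi_sigma_additive; exact: measurable_rV_cons.
Qed.

HB.instance Definition _ := isMeasure.Build _ _ _ lebesgue_rV_cons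
  lebesgue_rV_cons0 lebesgue_rV_cons_ge0 lebesgue_rV_cons_sigma_additive.

Let lebesgue_rV_cons_sigma_finite : sigma_finite setT lebesgue_rV_cons.
Proof.
have /sigma_finiteP[F [TF ndF Foo]] := sigma_finiteT (@lebesgue_measure R).
have /sigma_finiteP[G [TG ndG Goo]] := sigma_finiteT mu.
pose tl (y : 'rV[R]_n.+1) : measurableTypeR R * 'rV[R]_n :=
  (y ord0 ord0, \row_j y ord0 (lift ord0 j)).
have mtl : measurable_fun [set: _] tl.
  apply: measurable_fun_pair; first exact: measurable_coord_rV.
  apply: measurable_fun_rV => i.
  under eq_fun do rewrite mxE.
  exact: measurable_coord_rV.
have consK : cancel (@rV_cons n) tl.
  move=> x; rewrite /tl rV_cons0 [RHS]surjective_pairing; congr pair.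
  by apply/rowP => j; rewrite mxE rV_consS.
have mFG k : measurable (F k `*` G k).
  by have [? _] := Foo k; have [? _] := Goo k; exact: measurableX.
exists (fun k => tl @^-1` (F k `*` G k)).
  rewrite -preimage_bigcup; apply/seteqP; split => // y _.
  have [i _ Fi] : (\bigcup_k F k) (tl y).1 by rewrite -TF.
  have [j _ Gj] : (\bigcup_k G k) (tl y).2 by rewrite -TG.
  exists (maxn i j) => //; split.
  - by move: Fi; apply/subsetPset/ndF/leq_maxl.
  - by move: Gj; apply/subsetPset/ndG/leq_maxr.
move=> k; split.
  by rewrite -[X in measurable X]setTI; exact: mtl.
have [? Fk] := Foo k; have [? Gk] := Goo k.
rewrite /lebesgue_rV_cons /pushforward -comp_preimage.
have -> : tl \o @rV_cons n = id by apply/funext => x; exact: consK.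
rewrite preimage_id product_measure1E//.
by rewrite lte_mul_pinfty// ge0_fin_numE.
Qed.

HB.instance Definition _ := Measure_isSigmaFinite.Build _ _ _ lebesgue_rV_cons
  lebesgue_rV_cons_sigma_finite.

End cons.

Fixpoint lebesgue_rV n : {sigma_finite_measure set 'rV[R]_n -> \bar R} :=
  if n is n'.+1 then lebesgue_rV_cons (lebesgue_rV n') else \d_(0 : 'rV[R]_0).

End lebesgue_measure_rV.

Section sobolev.
Context {R : realType} {N : nat}.
Implicit Types (Omega : set 'rV[R]_N) (p lambda : R).
Implicit Types (f u v phi psi : 'rV[R]_N -> R) (G : 'rV[R]_N -> 'rV[R]_N).

Definition dot (x y : 'rV[R]_N) : R := \sum_i x ord0 i * y ord0 i.

(* The library norm on ['rV[R]_N] is the sup norm. *)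
Definition euclidean_norm (x : 'rV[R]_N) : R := Num.sqrt (dot x x).

Definition partial (i : 'I_N) phi : 'rV[R]_N -> R :=
  fun x => 'D_(delta_mx ord0 i) phi x.

Definition grad phi (x : 'rV[R]_N) : 'rV[R]_N := \row_i partial i phi x.

Definition smooth phi : Prop :=
  forall s : seq 'I_N, let g := foldr partial phi s in
    continuous g /\ forall i x, derivable g x (delta_mx ord0 i).

Definition support phi : set 'rV[R]_N := closure [set x | phi x != 0].

(* [phi] in C_0^\infty(Omega), extended by 0 to the whole space. *)
Definition test_function Omega phi : Prop :=
  [/\ smooth phi, compact (support phi) & support phi `<=` Omega].

(* Functions on [Omega] are represented by functions on the whole space, of
   which only the values on [Omega] are used: [f \_ Omega] is extension by 0. *)
Definition in_Lp Omega p f : Prop := (f \_ Omega) \in Lfun (lebesgue_rV N) p%:E.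

Definition Lp_norm Omega p f : \bar R :=
  'N[lebesgue_rV N]_p%:E[EFin \o (f \_ Omega)]%E.

Definition ae_nonneg Omega f : Prop :=
  {ae lebesgue_rV N, forall x, Omega x -> 0 <= f x}.

Definition ae_zero Omega f : Prop :=
  {ae lebesgue_rV N, forall x, Omega x -> f x = 0}.

Definition weak_gradient Omega u G : Prop :=
  forall phi, test_function Omega phi -> forall i,
    \int[lebesgue_rV N]_(x in Omega) (u x * partial i phi x) =
    - \int[lebesgue_rV N]_(x in Omega) (G x ord0 i * phi x).

(* [u] in W^{1,p}(Omega), with weak gradient [G]. *)
Definition sobolev Omega p u G : Prop :=
  [/\ in_Lp Omega p u, forall i, in_Lp Omega p (fun x => G x ord0 i)
    & weak_gradient Omega u G].

Definition sobolev_norm Omega p u G : \bar R :=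
  (Lp_norm Omega p u + \sum_i Lp_norm Omega p (fun x => G x ord0 i))%E.

(* W_0^{1,p}(Omega) is the closure of C_0^\infty(Omega) in W^{1,p}(Omega). *)
Definition sobolev0 Omega p u G : Prop :=
  sobolev Omega p u G /\
  forall eps : R, 0 < eps -> exists2 phi, test_function Omega phi &
    (sobolev_norm Omega p (phi \- u)%R (grad phi \- G)%R < eps%:E)%E.

Definition weak_solution Omega p lambda f u v : Prop :=
  exists Du Dv : 'rV[R]_N -> 'rV[R]_N,
  [/\ sobolev0 Omega p u Du, sobolev0 Omega 1 v Dv,
      ae_nonneg Omega u /\ ae_nonneg Omega v,
      forall phi, test_function Omega phi ->
        \int[lebesgue_rV N]_(x in Omega) dot (grad phi x) (Du x) =
        \int[lebesgue_rV N]_(x in Omega) (v x * phi x)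
    & forall psi, test_function Omega psi ->
        \int[lebesgue_rV N]_(x in Omega) dot (grad psi x) (Dv x) =
        \int[lebesgue_rV N]_(x in Omega)
          (euclidean_norm (Du x) `^ p * psi x) +
        lambda * \int[lebesgue_rV N]_(x in Omega) (f x * psi x)].

(* The relation [v = - Delta u] is the first equation of [weak_solution]. *)
Definition solution Omega p lambda f u : Prop :=
  exists v, weak_solution Omega p lambda f u v.

Definition positive_solution Omega p lambda f u : Prop :=
  solution Omega p lambda f u /\ ~ ae_zero Omega u.

End sobolev.

(* Main.v *)
(** Testing the second equation with a bump [psi] supported in a cube of side
    about [r], and integrating by parts three times, turns the system into
<<
      int |Du|^p psi + lambda int f psi = - int grad (Delta psi) . Du.
>>
    If [psi] is built from exp(-1/x), its third derivatives are bounded by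
    [C r^-3 psi^(1/p)], because a polynomial in 1/x is absorbed by any
    positive power of exp(-1/x).  Young's inequality then absorbs [|Du|^p psi] and
    leaves [lambda int f psi <= C r^(N - 3 p')], with [C] independent of [r].
    As [3 p' m < N], there is [f >= 0] in L^m whose integrals over small
    concentric cubes are not O(r^(N - 3 p')), and no solution exists for any
    [lambda > 0]. *)

Require Import Defs.
From HB Require Import structures.
From mathcomp Require Import all_boot all_order all_algebra.
From mathcomp Require Import all_classical all_reals all_analysis.
From mathcomp Require Import measurable_realfun ring lra.

Set Implicit Arguments.
Unset Strict Implicit.
Unset Printing Implicit Defensive.

Import Order.TTheory GRing.Theory Num.Theory.
Import numFieldNormedType.Exports.

Local Open Scope classical_set_scope.
Local Open Scope ring_scope.

Local Notation order0 := (fun=> 0%N).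

(** * The flat function exp(-1/x), its derivatives and their size *)

Section flat_exponential.
Context {R : realType}.
Implicit Types (P Q : {poly R}) (x y t e : R).

(** Induction along Horner's scheme: a factor [y] is absorbed by exp(-e y/2), through 1 + z <= exp
    z, and the other half of the decay is left to the induction hypothesis, which is therefore
    needed at rate [e / 2]. *)
Lemma poly_expRN_bounded P e : 0 < e ->
  exists2 C, 0 <= C & forall y, 0 <= y -> `|P.[y]| * expR (- (e * y)) <= C.
Proof.
elim/poly_ind: P e => [|P c IH] e e0.
  by exists 0 => // y _; rewrite horner0 normr0 mul0r.
have e20 : 0 < e / 2 by rewrite divr_gt0.
have [C C0 HC] := IH _ e20.
exists (C * (2 / e) + `|c|) => [|y y0].
  by rewrite addr_ge0// mulr_ge0// divr_ge0// ltW.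
rewrite hornerMXaddC.
have -> : (`|P.[y] * y + c| * expR (- (e * y)) : R) =
    `|P.[y] * y + c| * expR (- (e / 2 * y)) * expR (- (e / 2 * y)).
  by rewrite -mulrA -expRD; congr (_ * expR _); field.
have E2 : y * expR (- (e / 2 * y)) <= 2 / e.
  have := expR_ge1Dx (e / 2 * y).
  have E3 := expR_gt0 (e / 2 * y).
  move=> H; rewrite expRN ler_pdivrMr//.
  rewrite -[leLHS](_ : 2 / e * (e / 2 * y) = _); last by field; lra.
  rewrite ler_wpM2l ?divr_ge0 ?(ltW e0)//; lra.
have /ltW E3 := expR_gt0 (- (e / 2 * y)).
have E4 : expR (- (e / 2 * y)) <= 1.
  by rewrite -[leRHS]expR0 ler_expR oppr_le0 mulr_ge0// ltW.
apply: (@le_trans _ _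
    ((`|P.[y]| * y + `|c|) * expR (- (e / 2 * y)) * expR (- (e / 2 * y)))).
  rewrite !ler_wpM2r//; apply: (le_trans (ler_normD _ _)).
  by rewrite normrM (ger0_norm y0).
set E := expR _ in HC E2 E3 E4 *.
have := HC y y0; rewrite -/E => H1.
have -> : (`|P.[y]| * y + `|c|) * E * E =
    (`|P.[y]| * E) * (y * E) + `|c| * (E * E) by ring.
apply: lerD.
  by apply: ler_pM => //; rewrite mulr_ge0.
by rewrite -[leRHS]mulr1 ler_wpM2l// mulr_ile1//.
Qed.

(** Allowing a polynomial in 1/x in front of exp(-1/x) makes the family closed under
    differentiation. *)
Definition flat_exp P x : R := if 0 < x then P.[x^-1] * expR (- x^-1) else 0.

(** Chain rule: exp(-1/x) differentiates to x^-2 exp(-1/x), and P(1/x) to -x^-2 P'(1/x). *)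
Definition flat_exp_deriv P : {poly R} := 'X^2 * (P - P^`()).

(** The exponential bound for X^2 P controls P(1/x) x^-2 exp(-1/x). Quadratic decay is what
    differentiability at 0 requires. *)
Lemma flat_exp_quadratic P :
  exists2 C, 0 <= C & forall x, `|flat_exp P x| <= C * x ^+ 2.
Proof.
have [C C0 HC] := poly_expRN_bounded ('X^2 * P) ltr01.
exists C => // x; rewrite /flat_exp; case: ifPn => [x0|_]; last first.
  by rewrite normr0 mulr_ge0// sqr_ge0.
have := HC x^-1; rewrite invr_ge0 (ltW x0) => /(_ isT).
have x20 : 0 < x ^+ 2 by rewrite exprn_gt0.
have -> : ('X^2 * P).[x^-1] = P.[x^-1] / x ^+ 2.
  by rewrite hornerM hornerXn exprVn mulrC.
rewrite mul1r (normrM P.[_] (_ ^-1)) (gtr0_norm (_ : 0 < (x ^+ 2)^-1))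
  ?invr_gt0//.
by rewrite (normrM _ (expR _)) (ger0_norm (expR_ge0 _)) mulrAC ler_pdivrMr.
Qed.

Lemma is_derive_flat_exp P x :
  is_derive x (1 : R) (flat_exp P) (flat_exp (flat_exp_deriv P) x).
Proof.
have [x0|x0|->] := ltgtP x 0.
- have -> : flat_exp (flat_exp_deriv P) x = 0.
    by rewrite /flat_exp ltNge (ltW x0).
  apply: (@near_eq_is_derive _ _ _ (cst 0)).
  near=> y; rewrite /flat_exp ifF//=; apply/negbTE; rewrite -leNgt.
  by apply: ltW; near: y; exact: lt_nbhsl.
- apply: (@near_eq_is_derive _ _ _
    ((horner P \o (@GRing.inv R)) * (expR \o (- (@GRing.inv R))))).
    near=> y; rewrite /flat_exp ifT//.
    by near: y; exact: lt_nbhsr.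
  have xn0 : x != 0 by rewrite gt_eqF.
  have dV : is_derive x (1:R) (@GRing.inv R) (- x ^- 2).
    apply: (is_derive_eq (@is_deriveV _ id x 1 1 xn0 (is_derive_id _ _))).
    by rewrite scaler1.
  have d1 := is_derive1_comp (is_derive_poly P x^-1) dV.
  have d2 := @is_derive1_comp _ expR (- (@GRing.inv R)) _ _ _
    (is_derive_expR _) (is_deriveN dV).
  apply: (is_derive_eq (is_deriveM d1 d2)).
  rewrite /flat_exp x0 /flat_exp_deriv hornerM hornerXn hornerD hornerN exprVn
    /= /GRing.scale/=.
  by ring.
(* At 0 the difference quotient is squeezed between -C|h| and C|h|. *)
- have [C C0 HC] := flat_exp_quadratic P.
  have E0 Q : flat_exp Q 0 = 0 by rewrite /flat_exp ltxx.
  have cvC : C * `|h| @[h --> (0 : R)^'] --> (0 : R).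
    have /cvg_within_filter cv0 : `|h| @[h --> (0 : R)] --> `|0 : R|.
      exact: cvg_norm.
    by have := cvgM (cvg_cst C) (cv0 _); rewrite normr0 mulr0; apply.
  have : (h^-1 *: ((flat_exp P \o shift 0) (h *: (1 : R)) - flat_exp P 0))
      @[h --> 0^'] --> (0 : R).
    apply: (@squeeze_cvgr _ _ _ _
      (fun h : R => - (C * `|h|)) (fun h : R => C * `|h|)).
    + near=> h; rewrite E0 subr0 /= addr0 /GRing.scale/=
      mulr1 -ler_norml normrM normfV.
      have h0 : h != 0 by near: h; exact: nbhs_dnbhs_neq.
      rewrite ler_pdivrMl ?normr_gt0//.
      by apply: (le_trans (HC h)); rewrite [leRHS]mulrCA -expr2 real_normK//
        num_real.
    + have := cvgN cvC; rewrite oppr0; apply.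
    + exact: cvC.
  move=> H; apply: DeriveDef; first by apply/cvg_ex; exists 0.
  by rewrite E0; apply/cvg_lim.
Unshelve. all: by end_near. Qed.

(** In exp(-1/x) = exp(-e/x) exp(-(1-e)/x) the first factor absorbs the polynomial, and the second
    is the power on the right. *)
Lemma flat_exp_bound P e : 0 < e ->
  exists2 C, 0 <= C & forall x, `|flat_exp P x| <= C * flat_exp 1 x `^ (1 - e).
Proof.
move=> e0; have [C C0 HC] := poly_expRN_bounded P e0.
exists C => // x; rewrite /flat_exp; case: ifPn => [x0|_]; last first.
  by rewrite normr0 mulr_ge0// powR_ge0.
rewrite hornerC mul1r normrM (ger0_norm (expR_ge0 _)).
have := HC x^-1; rewrite invr_ge0 (ltW x0) => /(_ isT) H.
have E : expR (- x^-1) = expR (- (e * x^-1)) * expR (- ((1 - e) * x^-1)).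
  by rewrite -expRD; congr expR; ring.
rewrite [in leLHS]E mulrA.
apply: (@le_trans _ _ (C * expR (- ((1 - e) * x^-1)))).
  by rewrite ler_wpM2r ?expR_ge0.
by rewrite -expRM mulNr (mulrC x^-1).
Qed.

End flat_exponential.

(** * The one-dimensional bump and its derivatives *)

Section bump.
Context {R : realType}.
Implicit Types (t e : R) (s : seq ({poly R} * {poly R})).

(** The first factor vanishes for t <= -1 and the second for t >= 1, so each term lives on (-1,
    1). *)
Definition bump_term (PQ : {poly R} * {poly R}) t : R :=
  flat_exp PQ.1 (1 + t) * flat_exp PQ.2 (1 - t).

Definition bump_sum s t : R := \sum_(PQ <- s) bump_term PQ t.

(* The list [bump_seq k] encodes the [k]-th derivative of
   exp(-1/(1+t)) exp(-1/(1-t)) as a sum of terms [bump_term], by Leibniz. *)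
Fixpoint bump_seq k : seq ({poly R} * {poly R}) :=
  if k is k'.+1 then
    flatten [seq [:: (flat_exp_deriv PQ.1, PQ.2); (PQ.1, - flat_exp_deriv PQ.2)]
            | PQ <- bump_seq k']
  else [:: (1, 1)].

Definition bump_deriv k : R -> R := bump_sum (bump_seq k).

Lemma flat_expN (P : {poly R}) (x : R) : flat_exp (- P) x = - flat_exp P x.
Proof. by rewrite /flat_exp hornerN; case: ifP => _; rewrite ?mulNr ?oppr0. Qed.

Lemma is_derive_bump_term PQ t : is_derive t (1 : R) (bump_term PQ)
  (bump_term (flat_exp_deriv PQ.1, PQ.2) t +
   bump_term (PQ.1, - flat_exp_deriv PQ.2) t).
Proof.
have dl : is_derive t (1 : R) (cst (1 : R) + id) 1.
  by apply: is_derive_eq; rewrite add0r.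
have dr : is_derive t (1 : R) (cst (1 : R) - id) (-1).
  by apply: is_derive_eq; rewrite sub0r.
have d1 := @is_derive1_comp _ _ (cst 1 + id) _ _ _
  (is_derive_flat_exp PQ.1 (1 + t)) dl.
have d2 := @is_derive1_comp _ _ (cst 1 - id) _ _ _
  (is_derive_flat_exp PQ.2 (1 - t)) dr.
apply: (is_derive_eq (is_deriveM d1 d2)).
rewrite /bump_term/= flat_expN /GRing.scale/=; ring.
Qed.

Lemma is_derive_bump_deriv k t :
  is_derive t (1 : R) (bump_deriv k) (bump_deriv k.+1 t).
Proof.
rewrite /bump_deriv /=; elim: (bump_seq k) => [|PQ s IH] /=.
  have -> : bump_sum [::] = cst 0.
    by apply/funext => x; rewrite /bump_sum big_nil.
  exact: is_derive_cst.
have -> : bump_sum (PQ :: s) = bump_term PQ + bump_sum s.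
  by apply/funext => x; rewrite /bump_sum big_cons.
apply: (is_derive_eq (is_deriveD (is_derive_bump_term PQ t) IH)).
by rewrite /bump_sum !big_cons addrA.
Qed.

Lemma bump0E t : bump_deriv 0 t = flat_exp 1 (1 + t) * flat_exp 1 (1 - t).
Proof. by rewrite /bump_deriv /bump_sum big_seq1. Qed.

Lemma flat_exp1_ge0 (x : R) : 0 <= flat_exp 1 x.
Proof.
by rewrite /flat_exp; case: ifP => // _; rewrite hornerC mul1r expR_ge0.
Qed.

Lemma bump0_ge0 t : 0 <= bump_deriv 0 t.
Proof. by rewrite bump0E mulr_ge0 ?flat_exp1_ge0. Qed.

Lemma bump_deriv_out k t : 1 <= `|t| -> bump_deriv k t = 0.
Proof.
move=> t1; rewrite /bump_deriv /bump_sum big1// => PQ _;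
  rewrite /bump_term /flat_exp.
move: t1; rewrite ler_normr => /orP[] t1.
- by rewrite [X in _ * X]ifF ?mulr0//; apply/negbTE; rewrite -leNgt; lra.
- by rewrite ifF ?mul0r//; apply/negbTE; rewrite -leNgt; lra.
Qed.

(** In each Leibniz term the bounds of the two flat factors multiply to a power of the bump itself,
    and the constants add up over the list. *)
Lemma bump_bound k e : 0 < e ->
  exists2 C, 0 <= C &
    forall t, `|bump_deriv k t| <= C * bump_deriv 0 t `^ (1 - e).
Proof.
move=> e0; rewrite {1}/bump_deriv; elim: (bump_seq k) => [|PQ s [C C0 IH]].
  by exists 0 => // t; rewrite /bump_sum big_nil normr0 mul0r.
have [C1 C10 H1] := flat_exp_bound PQ.1 e0.
have [C2 C20 H2] := flat_exp_bound PQ.2 e0.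
exists (C1 * C2 + C) => [|t]; first by rewrite addr_ge0// mulr_ge0.
rewrite /bump_sum big_cons mulrDl (le_trans (ler_normD _ _))// lerD//.
  rewrite bump0E powRM ?flat_exp1_ge0// mulrACA normrM.
  by apply: ler_pM.
exact: IH.
Qed.

(** For |t| <= 1/2 both 1 + t and 1 - t are at least 1/2, where exp(-1/x) >= exp(-2). *)
Lemma bump0_lbound :
  exists2 c, 0 < c & forall t, `|t| <= 2^-1 -> c <= bump_deriv 0 t.
Proof.
exists (expR (-2) * expR (-2)) => [|t]; first by rewrite mulr_gt0 ?expR_gt0.
rewrite ler_norml => /andP[t1 t2]; rewrite bump0E.
have H (x : R) : 2^-1 <= x -> expR (-2) <= flat_exp 1 x.
  move=> x2; have x0 : 0 < x by lra.
  by rewrite /flat_exp x0 hornerC mul1r ler_expR lerN2 invf_ple ?posrE.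
by apply: ler_pM; rewrite ?expR_ge0//; apply: H; lra.
Qed.

End bump.

(** * Tensor products of rescaled bumps as test functions on cubes *)

Lemma powR_prod (R : realType) I (s : seq I) (F : I -> R) (e : R) :
  (forall i, 0 <= F i) ->
  (\prod_(i <- s) F i) `^ e = \prod_(i <- s) F i `^ e.
Proof.
move=> F0; elim: s => [|i s IH]; first by rewrite !big_nil powR1.
by rewrite !big_cons powRM ?IH// prodr_ge0.
Qed.

Section tensor.
Context {R : realType} {n : nat}.
Implicit Types (g : 'I_n -> R -> R) (x a : 'rV[R]_n) (r : R).

Definition tensor g x : R := \prod_i g i (x ord0 i).

(** Moving along the [j]-th axis changes only the [j]-th factor, so the difference quotient is a
    one-dimensional one times the constant [K]. *)
Lemma is_derive_tensor g x j (d : R) : is_derive (x ord0 j) (1 : R) (g j) d ->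
  is_derive x (delta_mx ord0 j) (tensor g)
    (d * \prod_(i | i != j) g i (x ord0 i)).
Proof.
move=> [dg dE]; set K := \prod_(i | _) _.
have cg : h^-1 *: ((g j \o shift (x ord0 j)) (h *: (1 : R)) - g j (x ord0 j))
    @[h --> 0^'] --> d by rewrite -dE; exact: dg.
have E : (fun h : R => h^-1 *: ((tensor g \o shift x) (h *: delta_mx ord0 j) -
      tensor g x)) =
    (fun h : R => h^-1 *: ((g j \o shift (x ord0 j)) (h *: (1 : R)) -
      g j (x ord0 j)) * K).
  apply/funext => h; rewrite /tensor /= (bigD1 j)//= [X in _ - X](bigD1 j)//=.
  rewrite !mxE !eqxx/= (eq_bigr (fun i => g i (x ord0 i))) => [|i ij].
    by rewrite -/K -mulrBl scalerAl.
  by rewrite !mxE (negbTE ij) andbF mulr0 add0r.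
have H : h^-1 *: ((tensor g \o shift x) (h *: delta_mx ord0 j) - tensor g x)
    @[h --> 0^'] --> d * K.
  by rewrite E; apply: cvgM => //; exact: cvg_cst.
by apply: DeriveDef; [apply/cvg_ex; exists (d * K)|exact/cvg_lim].
Qed.

Lemma continuous_tensor g : (forall i, continuous (g i)) ->
  continuous (tensor g).
Proof.
move=> cg x; rewrite /tensor.
apply: (@cvg_big _ _ _ _ _ (@mul_continuous _) _ (nbhs x)
  _ _ _ (nbhs_filter x)) => i _.
apply: (@continuous_comp _ _ _ (fun y : 'rV[R]_n => y ord0 i) (g i)).
  exact: coord_continuous.
exact: cg.
Qed.

Lemma measurable_tensor g D : (forall i, continuous (g i)) ->
  measurable_fun D (tensor g).
Proof.
move=> cg; apply: measurable_prod => i _; apply: measurable_funTS.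
apply: (measurableT_comp (f := g i)); last exact: measurable_coord_rV.
exact: continuous_measurable_fun.
Qed.

Definition cube a r : set 'rV[R]_n :=
  [set x | forall i, `|x ord0 i - a ord0 i| <= r].

Lemma compact_cube a r : compact (cube a r).
Proof.
have -> : cube a r = [set x | forall i,
    (`[a ord0 i - r, a ord0 i + r]%classic : set R) (x ord0 i)].
  by apply/seteqP; split => x H i; have := H i; rewrite /= in_itv/= ler_distl.
apply: (@rV_compact _ _ (fun i => `[a ord0 i - r, a ord0 i + r]%classic)) => i.
exact: segment_compact.
Qed.

Lemma closed_cube a r : closed (cube a r).
Proof. by apply: compact_closed (@compact_cube a r); exact: norm_hausdorff. Qed.

Lemma subset_cube a r r' : r <= r' -> cube a r `<=` cube a r'.
Proof. by move=> rr' x H i; exact: le_trans (H i) rr'. Qed.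

Lemma open_cube (A : set 'rV[R]_n) a : open A -> A a ->
  exists2 r, 0 < r & cube a r `<=` A.
Proof.
move=> oA Aa; have /nbhs_ballP[e /= e0 eA] : nbhs a A by exact: open_nbhs_nbhs.
exists (e / 2); first by rewrite divr_gt0.
move=> x Hx; apply: eA; split => // i j; rewrite (ord1 i).
apply: le_lt_trans (_ : e / 2 < e); last by rewrite ltr_pdivrMr// ltr_pMr//
  ltr1n.
by rewrite distrC; exact: Hx.
Qed.

(** This is the [k]-th derivative of the bump rescaled to centre [c] and radius [r]; the chain rule
    produces r^-k. *)
Definition scaled_bump (c : R) r k (t : R) : R :=
  r^-1 ^+ k * bump_deriv k ((t - c) / r).

Lemma is_derive_scaled_bump (c : R) r k (t : R) :
  is_derive t (1 : R) (scaled_bump c r k) (scaled_bump c r k.+1 t).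
Proof.
have d1 : is_derive t (1 : R) (fun t => (t - c) / r) r^-1.
  have d0 : is_derive t (1 : R) (id - cst c) (1 : R).
    by apply: is_derive_eq; rewrite subr0.
  have d := is_deriveM d0 (is_derive_cst (r^-1 : R) t 1).
  by apply: (is_derive_eq d); rewrite /= scaler0 add0r /GRing.scale/= mulr1.
have d2 := @is_derive1_comp _ _ (fun t => (t - c) / r) _ _ _
  (is_derive_bump_deriv k _) d1.
have d := is_deriveM (is_derive_cst (r^-1 ^+ k : R) t 1) d2.
apply: (is_derive_eq d); rewrite /= scaler0 addr0 /GRing.scale/=
  /scaled_bump exprSr.
by ring.
Qed.

Lemma continuous_scaled_bump (c : R) r k : continuous (scaled_bump c r k).
Proof.
move=> t; apply: differentiable_continuous; apply/derivable1_diffP.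
by have [] := is_derive_scaled_bump c r k t.
Qed.

(* [k] is a multi-index: this is the mixed derivative of order [k] of the
   product of the bumps rescaled to the cube of centre [a] and half-side [r]. *)
Definition bump_tensor a r (k : 'I_n -> nat) : 'rV[R]_n -> R :=
  tensor (fun i => scaled_bump (a ord0 i) r (k i)).

Definition incr (j : 'I_n) (k : 'I_n -> nat) : 'I_n -> nat :=
  fun i => ((i == j) + k i)%N.

Lemma is_derive_bump_tensor a r k j x : is_derive x (delta_mx ord0 j)
  (bump_tensor a r k) (bump_tensor a r (incr j k) x).
Proof.
apply: (is_derive_eq (is_derive_tensor
  (is_derive_scaled_bump (a ord0 j) r (k j) (x ord0 j)))).
rewrite /bump_tensor /tensor [RHS](bigD1 j)//= /incr eqxx; congr (_ * _).
by apply: eq_bigr => i /negbTE ->.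
Qed.

Lemma partial_bump_tensor a r k j :
  partial j (bump_tensor a r k) = bump_tensor a r (incr j k).
Proof. by apply/funext => x; have [] := is_derive_bump_tensor a r k j x. Qed.

Lemma bump_tensor_out a r k x :
  0 < r -> ~ cube a r x -> bump_tensor a r k x = 0.
Proof.
move=> r0 /existsNP[i /negP]; rewrite -ltNge => xi.
rewrite /bump_tensor /tensor (bigD1 i)//= /scaled_bump bump_deriv_out ?mulr0
  ?mul0r//.
by rewrite normrM normfV (gtr0_norm r0) ler_pdivlMr// mul1r ltW.
Qed.

Lemma test_function_bump_tensor (Omega : set 'rV[R]_n) a r k : 0 < r ->
  cube a r `<=` Omega -> test_function Omega (bump_tensor a r k).
Proof.
move=> r0 aO.
have sub : Defs.support (bump_tensor a r k) `<=` cube a r.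
  rewrite /Defs.support (iffLR (closure_id _) (@closed_cube a r)).
  by apply: closure_subset => x /= /eqP; apply: contra_notP =>
    /(bump_tensor_out k r0).
split; [|exact: subclosed_compact (@closed_closure _ _) (@compact_cube a r)
  sub|exact: subset_trans sub aO].
(* Every iterated partial derivative is again a bump tensor, so smoothness reduces to continuity and
   first derivatives within this family. *)
move=> s; have [k' ->] : exists k', foldr partial (bump_tensor a r k) s =
  bump_tensor a r k'.
  elim: s => [|j s [k' E]] /=; first by exists k.
  by exists (incr j k'); rewrite E partial_bump_tensor.
split => [|i x]; first by apply: continuous_tensor => i;
  exact: continuous_scaled_bump.
by have [] := is_derive_bump_tensor a r k' i x.
Qed.

Lemma measurable_bump_tensor a r k D : measurable_fun D (bump_tensor a r k).
Proof. by apply: measurable_tensor => i; exact: continuous_scaled_bump. Qed.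

Lemma bump_tensor0E a r x :
  bump_tensor a r order0 x = \prod_i bump_deriv 0 ((x ord0 i - a ord0 i) / r).
Proof. by apply: eq_bigr => i _; rewrite /scaled_bump expr0 mul1r. Qed.

Lemma bump_tensor0_ge0 a r x : 0 <= bump_tensor a r order0 x.
Proof. by rewrite bump_tensor0E prodr_ge0// => i _; exact: bump0_ge0. Qed.

(** The one-dimensional bounds multiply over the coordinates and the powers of 1/r add up to the
    total order. [C] is chosen before [a] and [r], so it serves all cubes at once. *)
Lemma bump_tensor_bound (k : 'I_n -> nat) (e : R) : 0 < e ->
  exists2 C, 0 <= C & forall a r x, 0 < r -> `|bump_tensor a r k x| <=
    C * r^-1 ^+ (\sum_i k i) * bump_tensor a r order0 x `^ (1 - e).
Proof.
move=> e0; have /choice[C HC] : forall i, exists c, 0 <= c /\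
    forall t : R, `|bump_deriv (k i) t| <= c * bump_deriv 0 t `^ (1 - e).
  by move=> i; have [c ? ?] := bump_bound (R := R) (k i) e0; exists c.
exists (\prod_i C i) => [|a r x r0]; first by rewrite prodr_ge0// => i _;
  have [] := HC i.
rewrite bump_tensor0E expr_sum powR_prod; last first.
  by move=> i; exact: bump0_ge0.
rewrite -!big_split normr_prod; apply: ler_prod => i _ /=; rewrite normr_ge0/=.
rewrite /scaled_bump normrM ger0_norm ?exprn_ge0 ?invr_ge0 ?(ltW r0)//.
rewrite -mulrA mulrCA ler_wpM2l ?exprn_ge0 ?invr_ge0 ?(ltW r0)//.
by have [] := HC i.
Qed.

Lemma bump_tensor_lbound : exists2 c : R, 0 < c &
  forall a r x, 0 < r -> cube a (r / 2) x -> c <= bump_tensor a r order0 x.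
Proof.
have [c c0 Hc] := @bump0_lbound R.
exists (\prod_(i < n) c) => [|a r x r0 Hx]; first by rewrite prodr_gt0.
rewrite bump_tensor0E; apply: ler_prod => i _; rewrite (ltW c0) Hc//.
by rewrite normrM normfV (gtr0_norm r0) ler_pdivrMr// mulrC.
Qed.

End tensor.

(** * Lebesgue measure of cubes *)

Section cube_measure.
Context {R : realType}.

Lemma measurable_cube n (a : 'rV[R]_n) (r : R) : measurable (cube a r).
Proof.
have -> : cube a r = \bigcap_(i in [set: 'I_n])
    ((fun x : 'rV[R]_n => x ord0 i) @^-1` `[a ord0 i - r, a ord0 i + r]).
  apply/seteqP; split => [x H i _|x H i]; last first.
    by have := H i I; rewrite /= in_itv/= -ler_distl.
  by rewrite /= in_itv/= -ler_distl; exact: H.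
apply: fin_bigcap_measurable => // i _; rewrite -[X in measurable X]setTI.
by apply: measurable_coord_rV => //; exact: measurable_itv.
Qed.

(** Induction on the dimension: the preimage of a cube under [rV_cons] is an interval times a cube
    of one dimension less. *)
Lemma lebesgue_rV_cube n (a : 'rV[R]_n) (r : R) : 0 <= r ->
  lebesgue_rV n (cube a r) = ((2 * r) ^+ n)%:E.
Proof.
move=> r0; elim: n a => [|n IH] a.
  rewrite expr0 /= diracE mem_set// => i; by case: i.
rewrite [LHS]/= /lebesgue_rV_cons /pushforward.
have -> : @rV_cons R n @^-1` cube a r =
    `[a ord0 ord0 - r, a ord0 ord0 + r]%classic `*` cube (\row_j a ord0 (lift
      ord0 j)) r.
  apply/seteqP; split => [[t x] /= H|[t x] /= [/= H1 H2] i].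
    split => /=; first by have := H ord0; rewrite rV_cons0 in_itv/= -ler_distl.
    by move=> i; have := H (lift ord0 i); rewrite rV_consS mxE.
  case: (unliftP ord0 i) => [j|] ->; first by rewrite rV_consS; have := H2 j;
    rewrite mxE.
  by rewrite rV_cons0 ler_distl; move: H1; rewrite in_itv.
rewrite product_measure1E//; last exact: measurable_cube.
rewrite IH exprS EFinM; congr (_ * _)%E.
rewrite [LHS](lebesgue_measure_itv `[a ord0 ord0 - r, a ord0 ord0 + r]) /=
  lte_fin.
have E : a ord0 ord0 + r - (a ord0 ord0 - r) = 2 * r by ring.
case: ifPn => [_|]; first by rewrite -EFinB E.
(* The interval formula returns 0 unless the endpoints are strictly ordered; this leaves r = 0,
   where [2 * r] vanishes too. *)
rewrite -leNgt => H; have -> : r = 0 by lra.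
by rewrite mulr0.
Qed.

End cube_measure.

(** * Comparison of the Euclidean norm with the coordinates *)

Lemma euclidean_norm_coord (R : realType) n (x : 'rV[R]_n) i :
  `|x ord0 i| <= euclidean_norm x.
Proof.
rewrite -sqrtr_sqr ler_sqrt ?sqr_ge0//; last by apply: sumr_ge0 => j _;
  rewrite -expr2 sqr_ge0.
rewrite /dot (bigD1 i)//= -expr2 lerDl; apply: sumr_ge0 => j _.
by rewrite -expr2 sqr_ge0.
Qed.

(** Every coordinate is at most S^(1/p). This transfers integrability from the p-th powers of the
    weak partial derivatives to |Du|^p. *)
Lemma euclidean_norm_powR (R : realType) n (x : 'rV[R]_n) (p : R) : 0 < p ->
  euclidean_norm x `^ p <= Num.sqrt n%:R `^ p * \sum_i `|x ord0 i| `^ p.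
Proof.
move=> p0; set S := \sum_i _.
have S0 : 0 <= S by apply: sumr_ge0 => i _; exact: powR_ge0.
have xS i : `|x ord0 i| <= S `^ p^-1.
  have -> : `|x ord0 i| = (`|x ord0 i| `^ p) `^ p^-1.
    by rewrite -powRrM divff ?gt_eqF// powRr1.
  apply: ge0_ler_powR; rewrite ?nnegrE ?powR_ge0 ?invr_ge0 ?(ltW p0)//.
  by rewrite /S (bigD1 i)//= lerDl sumr_ge0// => j _; exact: powR_ge0.
have H : euclidean_norm x <= Num.sqrt n%:R * S `^ p^-1.
  have -> : Num.sqrt n%:R * S `^ p^-1 = Num.sqrt (n%:R * (S `^ p^-1) ^+ 2).
    by rewrite sqrtrM ?ler0n// sqrtr_sqr ger0_norm ?powR_ge0.
  rewrite ler_sqrt ?mulr_ge0 ?ler0n ?powR_ge0//.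
  rewrite mulr_natl -[X in _ *+ X](card_ord n) -sumr_const.
  apply: ler_sum => i _; rewrite -expr2 -real_normK ?num_real//.
  by apply: lerXn2r; rewrite ?nnegrE ?powR_ge0.
have SE : S = (S `^ p^-1) `^ p by rewrite -powRrM mulVf ?gt_eqF// powRr1.
apply: (@le_trans _ _ ((Num.sqrt n%:R * S `^ p^-1) `^ p)).
  by apply: (ge0_ler_powR (ltW p0)); rewrite ?nnegrE ?mulr_ge0 ?sqrtr_ge0
    ?powR_ge0.
by rewrite powRM ?sqrtr_ge0 ?powR_ge0// -SE.
Qed.

(** * Integrability and finite sums of integrals *)

Section integrability.
Context d (T : measurableType d) (R : realType).
Context (mu : {measure set T -> \bar R}).
Implicit Types (D : set T) (f g h : T -> R).

Lemma integrable_bounded_mul D h g (M : R) : measurable D ->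
  measurable_fun D h -> (forall x, D x -> `|h x| <= M) ->
  mu.-integrable D (EFin \o g) ->
  mu.-integrable D (EFin \o (fun x => h x * g x)).
Proof.
move=> mD mh hM ig.
apply: (@integrableMr _ _ _ mu D mD h (EFin \o g)) => //.
exists M; split; first exact: num_real.
by move=> M' MM' x Dx; apply: le_trans (hM x Dx) (ltW MM').
Qed.

Lemma integrable_fin_sum D (I : Type) (s : seq I) (F : I -> T -> R) :
  measurable D -> (forall i, mu.-integrable D (EFin \o F i)) ->
  mu.-integrable D (EFin \o (fun x => \sum_(i <- s) F i x)).
Proof.
move=> mD iF; have := integrable_sum mD s (P := xpredT) (fun i _ => iF i).
by apply: eq_integrable => // x _ /=; rewrite sumEFin.
Qed.

Lemma Rintegral_fin_sum D (I : Type) (s : seq I) (F : I -> T -> R) :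
  measurable D -> (forall i, mu.-integrable D (EFin \o F i)) ->
  \int[mu]_(x in D) (\sum_(i <- s) F i x) =
  \sum_(i <- s) \int[mu]_(x in D) F i x.
Proof.
move=> mD iF; elim: s => [|i s IH].
  rewrite big_nil -[RHS](mul0r (fine (mu D))) -Rintegral_cst//.
  by apply: eq_Rintegral => x _; rewrite big_nil.
rewrite big_cons -IH -RintegralD//; last exact: integrable_fin_sum.
by apply: eq_Rintegral => x _; rewrite big_cons.
Qed.

(** Localises the integrals over [Omega] of the weak formulation to the cube carrying the test
    function. *)
Lemma Rintegral_vanish D E f : D `<=` E -> (forall x, ~ D x -> f x = 0) ->
  \int[mu]_(x in E) f x = \int[mu]_(x in D) f x.
Proof.
move=> DE f0; rewrite Rintegral_mkcond [RHS]Rintegral_mkcond.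
congr Rintegral; apply/funext => x; rewrite !patchE.
have [xD|xD] := boolP (x \in D).
  by rewrite mem_set//; apply: DE; exact: set_mem.
by case: ifP => // _; apply: f0 => /mem_set; exact/negP.
Qed.

Lemma integrable_fin_cst D (c : R) : measurable D -> (mu D < +oo)%E ->
  mu.-integrable D (EFin \o cst c).
Proof.
move=> mD Dfin; apply/integrableP; split.
  by apply/measurable_EFinP; exact: measurable_cst.
by rewrite (eq_integral (cst `|c|%:E))// integral_cst// lte_mul_pinfty.
Qed.

(** On a set of finite measure the integrable function 1 + |f|^p dominates |f|. *)
Lemma integrable_powR D f (p : R) : measurable D -> (mu D < +oo)%E -> 1 <= p ->
  measurable_fun D f -> mu.-integrable D (EFin \o (fun x => `|f x| `^ p)) ->
  mu.-integrable D (EFin \o f).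
Proof.
move=> mD Dfin p1 mf ifp.
have ic : mu.-integrable D (EFin \o cst (1 : R)).
  exact: integrable_fin_cst.
apply: (le_integrable mD _ _ (integrableD mD ic ifp)).
  exact/measurable_EFinP.
move=> x Dx /=; rewrite lee_fin [leRHS]ger0_norm ?addr_ge0 ?powR_ge0//.
have [f1|/ltW f1] := leP `|f x| 1; first by rewrite (le_trans f1)// lerDl
  powR_ge0.
rewrite (le_trans (y := `|f x| `^ p)) ?lerDr//.
rewrite -[leLHS]powRr1//; apply: ler_powR => //.
Qed.

End integrability.

(** * Integrability of L^q functions on subsets *)

Section in_Lp_theory.
Context {R : realType} {n : nat}.
Implicit Types (Omega Q : set 'rV[R]_n) (g : 'rV[R]_n -> R) (q : R).

Lemma in_Lp_measurable Omega Q q g : in_Lp Omega q g -> measurable Q ->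
  Q `<=` Omega -> measurable_fun Q g.
Proof.
move=> /sub_Lfun_mfun /set_mem /= mg mQ QO.
apply: (eq_measurable_fun (g \_ Omega)); last exact: measurable_funTS.
by move=> x /set_mem /QO xO; rewrite patchE mem_set.
Qed.

Lemma in_Lp_powR_integrable Omega Q q g : 0 < q -> in_Lp Omega q g ->
  measurable Q ->
  Q `<=` Omega ->
  (lebesgue_rV n).-integrable Q (EFin \o (fun x => `|g x| `^ q)).
Proof.
move=> q0 gq mQ QO.
have mg : measurable_fun [set: 'rV[R]_n] (g \_ Omega).
  by move: gq => /sub_Lfun_mfun /set_mem.
have gfin : (\int[lebesgue_rV n]_x (`|((g \_ Omega) x)%:E| `^ q) < +oo)%E.
  move: gq => /sub_Lfun_finLfun /set_mem; rewrite /= /finite_norm => H.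
  by have := poweR_lty q H; rewrite poweR_Lnorm ?gt_eqF.
have ig : (lebesgue_rV n).-integrable setT (EFin \o (fun x =>
  `|(g \_ Omega) x| `^ q)).
  apply/integrableP; split.
    apply/measurable_EFinP; apply: (measurableT_comp (measurable_powR q)).
    exact: measurableT_comp.
  by under eq_integral => x _ do rewrite /= ger0_norm ?powR_ge0// -poweR_EFin.
apply: (eq_integrable mQ _ _ _ (integrableS measurableT mQ (@subsetT _ Q) ig)).
by move=> x /set_mem /QO xO; rewrite /= patchE mem_set.
Qed.

Lemma in_Lp_integrable Omega Q q g : 1 <= q -> in_Lp Omega q g ->
  measurable Q ->
  (lebesgue_rV n Q < +oo)%E -> Q `<=` Omega ->
  (lebesgue_rV n).-integrable Q (EFin \o g).
Proof.
move=> q1 gq mQ Qfin QO; apply: (integrable_powR mQ Qfin q1).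
  exact: in_Lp_measurable gq mQ QO.
by apply: in_Lp_powR_integrable gq mQ QO; exact: lt_le_trans q1.
Qed.

End in_Lp_theory.

(** * The estimate of the datum on a single cube *)

Section test_estimate.
Context {R : realType} {n : nat}.
Implicit Types (Omega : set 'rV[R]_n) (p lambda r : R) (a x : 'rV[R]_n).

Local Notation mu := (lebesgue_rV n).

Lemma cube_measure_fin a r : 0 <= r -> (mu (cube a r) < +oo)%E.
Proof. by move=> r0; rewrite lebesgue_rV_cube// ltry. Qed.

Lemma dot_grad (phi : 'rV[R]_n -> R) (y : 'rV[R]_n) x :
  dot (grad phi x) y = \sum_j partial j phi x * y ord0 j.
Proof. by apply: eq_bigr => j _; rewrite mxE. Qed.

Lemma bump_tensor_bounded a r k : 0 < r ->
  exists M, forall x, `|bump_tensor a r k x| <= M.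
Proof.
move=> r0; have [C C0 H] := @bump_tensor_bound R n k 1 ltr01.
exists (C * r^-1 ^+ (\sum_i k i)) => x.
by apply: (le_trans (H a r x r0)); rewrite subrr powRr0 mulr1.
Qed.

Lemma integrable_bump_tensor_mul a r k (g : 'rV[R]_n -> R) : 0 < r ->
  mu.-integrable (cube a r) (EFin \o g) ->
  mu.-integrable (cube a r) (EFin \o (fun x => bump_tensor a r k x * g x)).
Proof.
move=> r0 ig; have [M HM] := bump_tensor_bounded a k r0.
apply: (integrable_bounded_mul (M := M)) => //; first exact: measurable_cube.
exact: measurable_bump_tensor.
Qed.

(** Young's inequality for s^(1/p) t and A, with the factors 1/p and 1/p' bounded by 1. In the
    application s is psi and t is |Du|. *)
Lemma young_absorption (p p' A s t : R) : 1 < p -> p' = p / (p - 1) ->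
  0 <= A -> 0 <= s -> 0 <= t ->
  A * s `^ p^-1 * t <= t `^ p * s + A `^ p'.
Proof.
move=> p1 p'E A0 s0 t0; have p0 : 0 < p by lra.
have p'0 : 0 < p' by rewrite p'E divr_gt0//; lra.
have pc : p^-1 + p'^-1 = 1 by rewrite p'E; field; lra.
have pV : p^-1 <= 1 by have : 0 < p'^-1 by [rewrite invr_gt0]; lra.
have p'V : p'^-1 <= 1 by have : 0 < p^-1 by [rewrite invr_gt0]; lra.
have st0 : 0 <= s `^ p^-1 * t by rewrite mulr_ge0 ?powR_ge0.
rewrite -mulrA mulrC; apply: (le_trans (conjugate_powR st0 A0 p0 p'0 pc)).
have -> : (s `^ p^-1 * t) `^ p = t `^ p * s.
  by rewrite powRM ?powR_ge0// -powRrM mulVf ?gt_eqF// powRr1// mulrC.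
by rewrite lerD// ler_piMr ?mulr_ge0 ?powR_ge0.
Qed.

(** Each of the [n * n] terms of grad (Delta psi) . Du is at most A psi^(1/p) |Du|, so Young leaves
    a constant to integrate over a cube of volume (2 r)^n. The dependence of [A] on [r] is left to
    the application. *)
Lemma weak_solution_estimate Omega p (p' : R) lambda (f u v : 'rV[R]_n ->
  R) a r (A : R) :
  1 < p -> p' = p / (p - 1) -> 0 < r -> cube a r `<=` Omega ->
  0 <= A -> (forall i j x, `|bump_tensor a r (incr j (incr i (incr i order0)))
    x| <=
                      A * bump_tensor a r order0 x `^ p^-1) ->
  weak_solution Omega p lambda f u v ->
  lambda * \int[mu]_(x in cube a r) (f x * bump_tensor a r order0 x) <=
  ((n * n)%:R * A) `^ p' * (2 * r) ^+ n.
Proof.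
move=> p1 p'E r0 QO A0 HC [Du [Dv [[[_ DuL _] _] [[_ DvL wDv] _] _ eq1 eq2]]].
set Q := cube a r in QO *; set B := bump_tensor a r in HC *.
pose psi := B order0; rewrite -/psi in HC *.
have mQ : measurable Q by exact: measurable_cube.
have Qfin : (mu Q < +oo)%E by apply: cube_measure_fin; exact: ltW.
have psi0 x : 0 <= psi x by exact: bump_tensor0_ge0.
have tB k : test_function Omega (B k) by exact: test_function_bump_tensor.
have B0 k x : ~ Q x -> B k x = 0 by exact: bump_tensor_out.
have p0 : 0 < p by lra.
have iDu j : mu.-integrable Q (EFin \o (fun x => Du x ord0 j)).
  by apply: (in_Lp_integrable (ltW p1) (DuL j)).
have iDv j : mu.-integrable Q (EFin \o (fun x => Dv x ord0 j)).
  by apply: (in_Lp_integrable (lexx _) (DvL j)).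
have iB k (g : 'rV[R]_n -> R) : mu.-integrable Q (EFin \o g) ->
    mu.-integrable Q (EFin \o (fun x => B k x * g x)).
  exact: integrable_bump_tensor_mul.
(* [ee i] is the multi-index of the second derivative in direction [i]; the double sum below is thus
   grad (Delta psi) . Du. *)
pose ee (i : 'I_n) : 'I_n -> nat := incr i (incr i order0).
have iG i : mu.-integrable Q (EFin \o (fun x =>
  \sum_j B (incr j (ee i)) x * Du x ord0 j)).
  by apply: integrable_fin_sum => // j; apply: iB.
have pB j k : partial j (B k) = B (incr j k) by exact: partial_bump_tensor.
have ppsi j : partial j psi = B (incr j order0) by exact: pB.
(* [v] is eliminated: the weak gradient of [v] and the first equation are both
   tested with second derivatives of [psi]. *)
have lhs : \int[mu]_(x in Omega) dot (grad psi x) (Dv x) =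
    - \int[mu]_(x in Q) \sum_i \sum_j B (incr j (ee i)) x * Du x ord0 j.
  rewrite (Rintegral_vanish mu QO); last first.
    move=> x Qx; rewrite dot_grad big1// => j _.
    by rewrite ?ppsi ?pB B0// mul0r.
  transitivity (\int[mu]_(x in Q) \sum_i B (incr i order0) x * Dv x ord0 i).
    by apply: eq_Rintegral => x _; rewrite dot_grad; apply: eq_bigr => i _;
      rewrite ?ppsi ?pB.
  rewrite !Rintegral_fin_sum//; last by move=> i; exact: iB.
  rewrite -sumrN; apply: eq_bigr => i _.
  transitivity (\int[mu]_(x in Omega) (Dv x ord0 i * B (incr i order0) x)).
    rewrite (Rintegral_vanish mu QO); last by move=> x Qx; rewrite B0// mulr0.
    by apply: eq_Rintegral => x _; rewrite mulrC.
  apply: oppr_inj; rewrite opprK -wDv// pB -eq1//.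
  rewrite (Rintegral_vanish mu QO); last first.
    move=> x Qx; rewrite dot_grad big1// => j _.
    by rewrite ?ppsi ?pB B0// mul0r.
  by apply: eq_Rintegral => x _; rewrite dot_grad; apply: eq_bigr => j _;
    rewrite ?ppsi ?pB.
have iH : mu.-integrable Q (EFin \o (fun x =>
  euclidean_norm (Du x) `^ p * psi x)).
  have iN : mu.-integrable Q (EFin \o (fun x => euclidean_norm (Du x) `^ p)).
    have iS : mu.-integrable Q (EFin \o (fun x => \sum_i `|Du x ord0 i| `^ p)).
      by apply: integrable_fin_sum => // i; exact: (in_Lp_powR_integrable p0
        (DuL i)).
    have iS' := integrableZl mQ (Num.sqrt n%:R `^ p) iS.
    apply: (le_integrable mQ _ _ iS').
      apply/measurable_EFinP; apply: (measurableT_comp (measurable_powR p)).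
      apply: (measurableT_comp (f := @Num.sqrt R)).
        by apply: continuous_measurable_fun; exact: sqrt_continuous.
      apply: measurable_sum => i; apply: measurable_funM.
        exact: in_Lp_measurable (DuL i) mQ QO.
      exact: in_Lp_measurable (DuL i) mQ QO.
    move=> x Qx /=; rewrite lee_fin ger0_norm ?powR_ge0//.
    by apply: (le_trans (euclidean_norm_powR _ p0)); exact: ler_norm.
  have := iB order0 _ iN; apply: eq_integrable => // x _ /=.
  by rewrite mulrC.
have := eq2 _ (tB order0); rewrite lhs.
rewrite (Rintegral_vanish mu QO); last by move=> x Qx; rewrite B0// mulr0.
rewrite [X in _ + _ * X](Rintegral_vanish mu QO); last by move=> x Qx;
  rewrite B0// mulr0.
rewrite -/psi.
set G := fun x => \sum_i _; set H := fun x => _ `^ p * _.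
set K := _ `^ p'.
have iGG : mu.-integrable Q (EFin \o G) by apply: integrable_fin_sum.
have iK : mu.-integrable Q (EFin \o cst K) by exact: integrable_fin_cst.
(* The tested equation reads - int G = int H + lambda int f psi, so nonnegativity of this integral
   bounds the datum term by K times the volume. *)
have : 0 <= \int[mu]_(x in Q) (G x + H x + K).
  apply: Rintegral_ge0 => x Qx.
  suff : - G x <= H x + K by lra.
  apply: (le_trans (ler_norm _)); rewrite normrN.
  have nA0 : 0 <= (n * n)%:R * A by rewrite mulr_ge0.
  have Y := young_absorption p1 p'E nA0 (psi0 x)
    (sqrtr_ge0 (dot (Du x) (Du x))).
  apply: le_trans Y.
  rewrite /G; apply: (le_trans (ler_norm_sum _ _ _)).
  (* The factor [n * n] is written as a double constant sum, to be compared with [G] term by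
     term. *)
  rewrite natrM -!mulrA mulr_natl -[X in _ *+ X](card_ord n) -sumr_const.
  apply: ler_sum => i _; apply: (le_trans (ler_norm_sum _ _ _)).
  rewrite mulr_natl -[X in _ *+ X](card_ord n) -sumr_const.
  apply: ler_sum => j _; rewrite normrM !mulrA.
  by apply: ler_pM => //; [exact: HC|exact: euclidean_norm_coord].
rewrite RintegralD//; last by have := integrableD mQ iGG iH;
  apply: eq_integrable.
have muQ : fine (mu Q) = (2 * r) ^+ n by rewrite lebesgue_rV_cube ?(ltW r0).
rewrite RintegralD// Rintegral_cst// [fine _]muQ.
lra.
Qed.

End test_estimate.

(** * An L^m datum with prescribed lower bounds on concentric cubes *)

Lemma Rintegral_lower_bound d (T : measurableType d) (R : realType)
    (mu : {measure set T -> \bar R}) (D E : set T) (f g : T -> R) (b c : R) :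
  measurable D -> measurable E -> D `<=` E -> (mu D < +oo)%E ->
  0 <= b -> 0 <= c ->
  (forall x, 0 <= f x) -> {ae mu, forall x, D x -> b <= f x} ->
  (forall x, 0 <= g x) -> (forall x, D x -> c <= g x) ->
  mu.-integrable E (EFin \o (fun x => f x * g x)) ->
  b * c * fine (mu D) <= \int[mu]_(x in E) (f x * g x).
Proof.
move=> mD mE DE Dfin b0 c0 f0 bf g0 cg ifg.
have mfg : measurable_fun E (EFin \o (fun x => f x * g x)).
  exact: measurable_int ifg.
rewrite -lee_fin fineK; last exact: integrable_fin_num.
rewrite EFinM fineK ?ge0_fin_numE// -integral_cst//.
apply: (@le_trans _ _ (\int[mu]_(x in D) (f x * g x)%:E)%E).
  apply: ae_ge0_le_integral => //.
  - by move=> x _; rewrite lee_fin mulr_ge0.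
  - by move=> x _; rewrite lee_fin mulr_ge0.
  - exact: measurable_funS mfg.
  - by apply: filterS bf => x bfx Dx; rewrite lee_fin ler_pM//;
    [exact: bfx|exact: cg].
apply: ge0_subset_integral => //.
by move=> x _; rewrite lee_fin mulr_ge0.
Qed.

Lemma powR_small (R : realType) (s rho eps : R) : 0 < s -> 0 < rho -> 0 < eps ->
  exists2 r, 0 < r <= rho & r `^ s <= eps.
Proof.
move=> s0 rho0 eps0; exists (Num.min rho (eps `^ s^-1)).
  by rewrite lt_min rho0 powR_gt0//= ge_min lexx.
rewrite -[leRHS](powRr1 (ltW eps0)) -(mulVf (lt0r_neq0 s0)) powRrM.
by apply: (ge0_ler_powR (ltW s0)); rewrite ?nnegrE ?powR_ge0 ?ge_min ?lexx
  ?orbT// le_min ltW//= powR_ge0.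
Qed.

(** [f] is the m-th root of the series [F] of c_k^m times the indicators of the cubes. Its L^m norm
    is controlled by a geometric series, and on the [k]-th cube the [k]-th term alone gives f >= c_k
    wherever [F] is finite. *)
Lemma in_Lp_cube_lower_bounds (R : realType) n (Omega : set 'rV[R]_n) a (m : R)
    (rho c : nat -> R) :
  0 < m -> (forall k, 0 <= rho k) -> (forall k, 0 <= c k) ->
  (forall k, cube a (rho k) `<=` Omega) ->
  (forall k, c k `^ m * (2 * rho k) ^+ n <= (2 ^ k.+1)%:R^-1) ->
  exists f : 'rV[R]_n -> R, [/\ in_Lp Omega m f, forall x, 0 <= f x &
    forall k, {ae lebesgue_rV n, forall x, cube a (rho k) x -> c k <= f x}].
Proof.
move=> m0 rho0 c0 cO small; set mu := lebesgue_rV n.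
pose t k (x : 'rV[R]_n) : \bar R := (c k `^ m * \1_(cube a (rho k)) x)%:E.
have t0 k x : (0 <= t k x)%E by rewrite lee_fin mulr_ge0 ?powR_ge0.
pose F x : \bar R := (\sum_(k <oo) t k x)%E.
have mt k : measurable_fun [set: 'rV[R]_n] (t k).
  apply/measurable_EFinP; apply: measurable_funM; first exact: measurable_cst.
  by apply: measurable_indic; exact: measurable_cube.
have F0 x : (0 <= F x)%E by apply: nneseries_ge0.
have mF : measurable_fun [set: 'rV[R]_n] F.
  by apply: ge0_emeasurable_sum => // k x _ _; exact: t0.
have intF : (\int[mu]_x F x < +oo)%E.
  rewrite /F integral_nneseries//.
  apply: (@le_lt_trans _ _ (\sum_(k <oo) (1 / (2 ^ (k + 1))%:R)%:E)%E);
    last first.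
    by rewrite (cvg_lim _ (@cvg_geometric_eseries_half R 1 0))// ltry.
  apply: lee_nneseries => [k _ _|k _]; first by apply: integral_ge0 => x _;
    exact: t0.
  rewrite /t; under eq_integral do rewrite EFinM.
  rewrite ge0_integralZl//; last 2 first.
  - by apply/measurable_EFinP; apply: measurable_indic; exact: measurable_cube.
  - by rewrite lee_fin powR_ge0.
  rewrite integral_indic//; last exact: measurable_cube.
  by rewrite setIT [X in (_ * X)%E](lebesgue_rV_cube a (rho0 k)) -EFinM lee_fin
    div1r addn1.
have Ffin : {ae mu, forall x, F x \is a fin_num}.
  have iF : mu.-integrable setT F.
    by apply/integrableP; split => //; under eq_integral do rewrite gee0_abs//.
  by apply: filterS (integrable_ae measurableT iF) => x; apply.
(* Consequently restricting [f] to [Omega] does not change it. *)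
have Fout x : ~ Omega x -> F x = 0.
  move=> Ox; rewrite /F eseries0// => k _ _; rewrite /t indicE memNset ?mulr0//.
  by move=> kx; exact: Ox (cO k x kx).
(* [fine +oo = 0], but [F] is infinite on a null set only. *)
pose f x := fine (F x) `^ m^-1.
have fE : f \_ Omega = f.
  apply/funext => x; rewrite patchE; case: ifPn => // /negP xO.
  by rewrite /f Fout ?powR0 ?invr_neq0 ?gt_eqF// => Ox; apply: xO;
    exact: mem_set.
have mf : measurable_fun [set: 'rV[R]_n] f.
  apply: (measurableT_comp (measurable_powR m^-1)).
  exact: measurableT_comp.
have fm x : f x `^ m = fine (F x).
  by rewrite /f -powRrM mulVf ?gt_eqF// powRr1// fine_ge0.
exists f; split => [|x|k].
- rewrite /in_Lp fE; apply/andP; split; first exact: mem_set.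
  apply: mem_set; rewrite /= /finite_norm unlock /=; apply: poweR_lty.
  apply: le_lt_trans intF; apply: ge0_le_integral => //.
  + apply/measurable_EFinP; apply: (measurableT_comp (measurable_powR m)).
    exact: measurableT_comp.
  + move=> x _; rewrite ger0_norm ?powR_ge0// fm.
    have fine_le_self (y : \bar R) : (0 <= y -> (fine y)%:E <= y)%E.
      by case: y => // _; rewrite leey.
    exact: fine_le_self.
- exact: powR_ge0.
- apply: filterS Ffin => x Fx kx.
  have ck : c k = (c k `^ m) `^ m^-1 by rewrite -powRrM divff ?gt_eqF// powRr1.
  rewrite {1}ck /f; apply: ge0_ler_powR.
  + by rewrite invr_ge0 ltW.
  + by rewrite nnegrE powR_ge0.
  + by rewrite nnegrE fine_ge0.
  rewrite -lee_fin fineK// /F (@nneseriesD1 R (t ^~ x) k xpredT)//.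
  rewrite /t indicE mem_set// mulr1 leeDl// nneseries_ge0// => j _ _.
  exact: t0.
Qed.

(** * Contradiction along shrinking cubes *)

Lemma sum_incr n (j : 'I_n) (k : 'I_n -> nat) :
  (\sum_i incr j k i = (\sum_i k i).+1)%N.
Proof.
by rewrite big_split/= (bigD1 j)//= eqxx big1// => i /negbTE ->.
Qed.

Theorem theorem2p5 (R : realType) (N : nat) (Omega : set 'rV[R]_N) (p p' m : R)
    (Omega_open : open Omega) (Omega_bounded : bounded_set Omega)
    (Omega_neq0 : Omega !=set0) (p_gt1 : 1 < p) (p'E : p' = p / (p - 1))
    (m_ge1 : 1 <= m) (m_lt : m < Num.max 1 (N%:R / (3 * p'))) :
  exists f : 'rV[R]_N -> R,
    [/\ in_Lp Omega m f, ae_nonneg Omega f, ~ ae_zero Omega f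
      & forall lambda : R, 0 < lambda ->
          ~ exists u : 'rV[R]_N -> R, positive_solution Omega p lambda f u].
Proof.
have p'0 : 0 < p' by rewrite p'E divr_gt0//; lra.
have m0 : 0 < m by lra.
have exponent : 0 < N%:R - 3 * p' * m.
  (* As m >= 1, only the second entry of the maximum can exceed m. *)
  move: m_lt; rewrite lt_max ltNge m_ge1/= ltr_pdivlMr;
    last by rewrite mulr_gt0.
  by rewrite subr_gt0 mulrC.
have [a Oa] := Omega_neq0.
have [rho rho0 rhoO] := open_cube Omega_open Oa.
(* With height (k+1) r^(-3p') on a cube of side r, the m-th power integrates to (k+1)^m r^(N -
   3p'm), which this choice keeps below 2^-(k+1). *)
have /choice[r Hr] : forall k, exists r, 0 < r <= rho /\
    r `^ (N%:R - 3 * p' * m) <= (2 ^ k.+1)%:R^-1 / k.+1%:R `^ m.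
  move=> k; have e0 : 0 < (2 ^ k.+1)%:R^-1 / k.+1%:R `^ m :> R.
    by rewrite divr_gt0 ?powR_gt0// invr_gt0 ltr0n expn_gt0.
  by have [r ? ?] := powR_small exponent rho0 e0; exists r.
have r0 k : 0 < r k by have [/andP[]] := Hr k.
have rO k : cube a (r k) `<=` Omega.
  by apply: subset_trans rhoO; apply: subset_cube; have [/andP[]] := Hr k.
(* The height beats the critical rate [r k `^ (- (3 * p'))] by the factor
   [k.+1], and [r k] is so small that the [L^m] norms remain summable. *)
pose c k : R := k.+1%:R * r k `^ (- (3 * p')).
have c0 k : 0 < c k by rewrite mulr_gt0 ?ltr0n ?powR_gt0.
have r20 k : 0 <= r k / 2 by rewrite divr_ge0// ltW.
have half_sub k : cube a (r k / 2) `<=` cube a (r k).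
  by apply: subset_cube; have := r0 k; lra.
have [f [fL f0 fc]] : exists f : 'rV[R]_N -> R,
    [/\ in_Lp Omega m f, forall x, 0 <= f x &
    forall k, {ae lebesgue_rV N, forall x, cube a (r k / 2) x -> c k <= f x}].
  apply: in_Lp_cube_lower_bounds => // [k|k|k].
  - exact: ltW.
  - exact: subset_trans (half_sub k) (rO k).
  - have -> : 2 * (r k / 2) = r k by field.
    have [_] := Hr k; rewrite ler_pdivlMr ?powR_gt0//.
    apply: le_trans; rewrite /c powRM ?powR_ge0 ?ler0n//.
    rewrite -powR_mulrn ?(ltW (r0 k))// -mulrA -(powRrM (r k)) -powRD;
      last first.
      by rewrite lt0r_neq0 ?implybT.
    by rewrite mulrC mulNr addrC.
exists f; split => //.
- by apply: aeW => x _; exact: f0.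
(* If [f] vanished almost everywhere, the cube where f >= c_0 > 0 would be null, against its volume
   r_0^N. *)
- move=> fz.
  have Q0 : (lebesgue_rV N).-negligible (cube a (r 0%N / 2)).
    apply: negligibleS (filterI fz (fc 0%N)) => x Qx /= [fx cx].
    have := cx Qx; rewrite fx; last exact/rO/half_sub.
    by rewrite leNgt c0.
  have muQ0 := iffLR (negligibleP _ (measurable_cube a (r 0%N / 2))) Q0.
  have [] := etrans (esym (lebesgue_rV_cube a (r20 0%N))) muQ0; apply/eqP.
  by rewrite expf_neq0// lt0r_neq0// mulr_gt0// divr_gt0.
move=> lambda l0 [u [[v uv] _]].
(* Then 1 - e = 1/p, the power of psi required for Young. *)
pose e : R := 1 - p^-1.
have e0 : 0 < e by rewrite subr_gt0 invf_lt1//; lra.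
have /choice[C HC] : forall ij : 'I_N * 'I_N, exists c, 0 <= c /\
    forall a r x, 0 < r ->
    `|bump_tensor a r (incr ij.2 (incr ij.1 (incr ij.1 order0))) x| <=
    c * r^-1 ^+ 3 * bump_tensor a r order0 x `^ p^-1.
  move=> [i j].
  have [c1 c10 H] := bump_tensor_bound (R := R)
    (incr j (incr i (incr i order0))) e0.
  exists c1; split => // b s x s0; have := H b s x s0; rewrite subKr.
  suff -> : (\sum_i0 incr j (incr i (incr i (fun=> 0))) i0 = 3)%N by [].
  by rewrite !sum_incr big1.
(* The sum dominates the constants of all index pairs and does not depend on [k]. *)
pose K := \sum_ij C ij.
have K0 : 0 <= K by apply: sumr_ge0 => ij _; have [] := HC ij.
have [b b0 Hb] := @bump_tensor_lbound R N.
pose M := ((N * N)%:R * K) `^ p' * 2 ^+ N.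
(* Both the lower bound of the datum integral and the estimate carry r_k^(-3p') r_k^N; after
   cancellation only the factor k+1 still depends on [k]. *)
have bound k : lambda * b * k.+1%:R <= M.
  have sk : 0 <= (r k)^-1 ^+ 3 by rewrite exprn_ge0// invr_ge0 ltW.
  have A0 : 0 <= K * (r k)^-1 ^+ 3 by rewrite mulr_ge0.
  have HA i j x : `|bump_tensor a (r k) (incr j (incr i (incr i order0))) x| <=
      K * (r k)^-1 ^+ 3 * bump_tensor a (r k) order0 x `^ p^-1.
    have [_ /(_ a (r k) x (r0 k)) H] := HC (i, j); apply: (le_trans H).
    rewrite ler_wpM2r ?powR_ge0// ler_wpM2r// /K (bigD1 (i, j))//= lerDl.
    by apply: sumr_ge0 => ij _; have [] := HC ij.
  have := weak_solution_estimate p_gt1 p'E (r0 k) (@rO k) A0 HA uv.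
  have Qfin : (lebesgue_rV N (cube a (r k)) < +oo)%E.
    by apply: cube_measure_fin; exact: ltW.
  have ifB : (lebesgue_rV N).-integrable (cube a (r k))
      (EFin \o (fun x => f x * bump_tensor a (r k) order0 x)).
    have mQ := measurable_cube a (r k).
    have := integrable_bump_tensor_mul order0 (r0 k)
      (in_Lp_integrable m_ge1 fL mQ Qfin (@rO k)).
    by apply: eq_integrable => // x _ /=; rewrite mulrC.
  have := Rintegral_lower_bound
    (measurable_cube a (r k / 2)) (measurable_cube a (r k)) (@half_sub k)
    (cube_measure_fin a (r20 k)) (ltW (c0 k)) (ltW b0) f0 (fc k)
    (@bump_tensor0_ge0 _ _ a (r k)) (fun x => Hb a (r k) x (r0 k)) ifB.
  have -> : fine (lebesgue_rV N (cube a (r k / 2))) = r k ^+ N.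
    by rewrite lebesgue_rV_cube//=; congr (_ ^+ _); field.
  move=> H1 H2; have {H1} := le_trans (ler_wpM2l (ltW l0) H1) H2.
  have rN : 0 < r k ^+ N by rewrite exprn_gt0.
  rewrite (_ : ((N * N)%:R * (K * (r k)^-1 ^+ 3)) `^ p' =
    ((N * N)%:R * K) `^ p' * r k `^ (- (3 * p'))); last first.
    rewrite mulrA powRM//; last by rewrite mulr_ge0.
    congr (_ * _).
    by rewrite exprVn -powR_mulrn ?(ltW (r0 k))// -powRN -powRrM mulNr.
  rewrite exprMn /c /M; set P := _ `^ (- _);
  have P0 : 0 < P by rewrite powR_gt0.
  set L := _ `^ p' => H.
  rewrite -(ler_pM2r rN) -(ler_pM2r P0).
  by apply: le_trans (le_trans _ H) _; rewrite le_eqVlt; apply/orP; left;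
    apply/eqP; ring.
have lb0 : 0 < lambda * b by rewrite mulr_gt0.
have M0 : 0 <= M / (lambda * b).
  by rewrite divr_ge0 ?(ltW lb0)// mulr_ge0 ?powR_ge0 ?exprn_ge0.
(* The Archimedean property provides a [k] violating [bound]. *)
have := archi_boundP M0; rewrite ltr_pdivrMr// ltNge => /negP; apply.
apply: le_trans (bound (Num.bound (M / (lambda * b)))).
by rewrite mulrC ler_pM2l// ler_nat.
Qed.
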